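(* Let $\ell\ge2$ be an integer, $a>0$, $b>0$, $\lambda>0$, $\rho\in\mathbb{R}$, and $c_1=-\lambda\rho+b$. Assume $\rho<0$. Then there exists a unique stationary solution $u_{\rm stat}$ (in the sense defined in the context) associated with the problem $$\begin{cases} u_t=-[(b\ell v^{\ell-1}-c_1)u]_x+a u_{xx}, & (x,t)\in(0,\infty)^2,\\ v(x,t)=\int_x^\infty u(y,t)\,dy, & (x,t)\in(0,\infty)^2,\\ (c_1-b\ell)u(0,t)+a u_x(0,t)=0, & t\in(0,\infty),\\ u(x,t)\,dx\to\xi_0(dx) \text{ weakly as } t\downarrow0. \end{cases}$$ It is given, together with $v_{\rm stat}(x)=\int_x^\infty u_{\rm stat}(y)\,dy$, for $x\in\mathbb{R}_+$ by $$v_{\rm stat}(x)=w(x)^{-1/(\ell-1)},\qquad u_{\rm stat}(x)=\frac{c_1}{a}(1-\alpha)e^{\frac{c_1}{a}(\ell-1)x}w(x)^{-\ell/(\ell-1)},$$ $$w(x)=(1-\alpha)e^{\frac{c_1}{a}(\ell-1)x}+\alpha,\qquad \alpha=\frac{b}{c_1}=\Big(1-\lambda\frac{\rho}{b}\Big)^{-1}\in(0,1).$$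
   Context: $\mathbb{R}_+=[0,\infty)$. For a Borel probability measure $\xi_0$ on $\mathbb{R}_+$ with finite second moment, the displayed problem has a unique solution in the class of nonnegative $u\in C^{2,1}(\mathbb{R}_+\times(0,\infty))$ (derivatives continuous up to $x=0$) with $\sup_{t\in(0,T]}\int_{\mathbb{R}_+}xu(x,t)dx<\infty$ for every $T<\infty$; this is ''the solution''. A function $u_{\rm stat}\in C^2(\mathbb{R}_+)$ is a stationary solution associated with the problem if it is a probability density with finite second moment and, setting $\xi_0(dx)=u_{\rm stat}(x)dx$, the solution of the problem is $u(x,t)=u_{\rm stat}(x)$ for all $x,t$. *)

(* Defs.v *)
From HB Require Import structures.
From mathcomp Require Import all_boot all_order all_algebra.
From mathcomp Require Import all_classical all_reals all_analysis.
Import Order.TTheory GRing.Theory Num.Theory.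
Import numFieldNormedType.Exports.

Set Implicit Arguments.
Unset Strict Implicit.
Unset Printing Implicit Defensive.

Local Open Scope classical_set_scope.
Local Open Scope ring_scope.

(* Functions on R_+ and on R_+ x (0, +oo) are total functions on R and R x R
   whose values outside these domains are never used. *)
Definition Rp {R : realType} : set R := `[0, +oo[.

(* Derivative of a function on R_+: the ordinary derivative at x > 0 and the
   right derivative at x = 0. *)
Definition derivable_Rp {R : realType} (f : R -> R) (x : R) : Prop :=
  cvg ((f y - f x) / (y - x) @[y --> within Rp x^']).

Definition derive_Rp {R : realType} (f : R -> R) (x : R) : R :=
  lim ((f y - f x) / (y - x) @[y --> within Rp x^']).

Definition C2_Rp {R : realType} (f : R -> R) : Prop :=
  [/\ forall x : R, 0 <= x -> derivable_Rp f x,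
      forall x : R, 0 <= x -> derivable_Rp (derive_Rp f) x &
      {within Rp, continuous (derive_Rp (derive_Rp f))}].

(* Partial derivatives of u(x, t), u : R -> R -> R. *)
Definition dx {R : realType} (u : R -> R -> R) (x t : R) : R :=
  derive_Rp (u^~ t) x.

Definition dt {R : realType} (u : R -> R -> R) (x t : R) : R := derive1 (u x) t.

Definition continuous_xt {R : realType} (u : R -> R -> R) : Prop :=
  {within [set z : R * R | 0 <= z.1 /\ 0 < z.2],
    continuous (fun z : R * R => u z.1 z.2)}.

(* C^{2,1}(R_+ x (0, +oo)), derivatives continuous up to x = 0. *)
Definition C21 {R : realType} (u : R -> R -> R) : Prop :=
  (forall x t : R, 0 <= x -> 0 < t ->
     [/\ derivable_Rp (u^~ t) x, derivable_Rp ((dx u)^~ t) x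
       & derivable (u x) t 1]) /\
  [/\ continuous_xt u, continuous_xt (dx u), continuous_xt (dx (dx u))
    & continuous_xt (dt u)].

Definition tail {R : realType} (f : R -> R) (x : R) : R :=
  Rintegral lebesgue_measure `[x, +oo[ f.

Definition solution_class {R : realType} (u : R -> R -> R) : Prop :=
  [/\ forall x t : R, 0 <= x -> 0 < t -> 0 <= u x t,
      C21 u &
      forall T : R,
        (ereal_sup [set \int[lebesgue_measure]_(x in Rp) (x * u x t)%:E
                   | t in [set t : R | (0 < t <= T)%R]] < +oo)%E].

(* u(x,t) dx --> xi0(dx) weakly on R_+ as t decreases to 0. *)
Definition weak_initial_value {R : realType}
    (xi0 : probability (measurableTypeR R) R) (u : R -> R -> R) : Prop :=
  forall phi : R -> R,
    {within Rp, continuous phi} ->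
    (exists M : R, forall x : R, 0 <= x -> `|phi x| <= M) ->
    Rintegral lebesgue_measure Rp (fun x => phi x * u x t) @[t --> 0^'+]
      --> Rintegral xi0 Rp phi.

Definition is_solution {R : realType} (l : nat) (a b c1 : R)
    (xi0 : probability (measurableTypeR R) R) (u : R -> R -> R) : Prop :=
  let v x t := tail (u^~ t) x in
  [/\ solution_class u,
      forall x t : R, 0 < x -> 0 < t ->
        dt u x t =
          - dx (fun y s => (b * l%:R * v y s ^+ l.-1 - c1) * u y s) x t
          + a * dx (dx u) x t,
      forall t : R, 0 < t -> (c1 - b * l%:R) * u 0 t + a * dx u 0 t = 0 &
      weak_initial_value xi0 u].

(* A solution with given xi0 is unique in [solution_class], so "the solution
   started from u(x) dx is constantly u" reads: u, constant in time, is a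
   solution started from u(x) dx. *)
Definition is_stationary {R : realType} (l : nat) (a b c1 : R) (u : R -> R)
    : Prop :=
  [/\ C2_Rp u,
      forall x : R, 0 <= x -> 0 <= u x,
      (\int[lebesgue_measure]_(x in Rp) (u x)%:E = 1)%E,
      (\int[lebesgue_measure]_(x in Rp) (x ^+ 2 * u x)%:E < +oo)%E &
      exists2 xi0 : probability (measurableTypeR R) R,
        (forall A : set (measurableTypeR R), measurable A ->
           (xi0 A = \int[lebesgue_measure]_(x in A `&` Rp) (u x)%:E)%E) &
        is_solution l a b c1 xi0 (fun x _ => u x)].

(* Main.v *)
(* With v(x) = int_x^oo u, stationarity says that the flux
   (b l v^(l-1) - c1) u - a u' is constant on R_+, and the boundary condition
   together with v(0) = 1 makes it vanish.  Since v' = -u, this is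
   (a u + b v^l - c1 v)' = 0; the constant is 0 because v tends to 0 at
   infinity and u cannot stay above a positive constant.  Hence
   a v' = b v^l - c1 v, and w v^(l-1) - 1 solves a linear homogeneous equation
   with value 0 at x = 0, so v = w^(-1/(l-1)).  Conversely, this v satisfies
   the same first-order equation, from which everything else is read off. *)
Require Import Defs.
From HB Require Import structures.
From mathcomp Require Import all_boot all_order all_algebra.
From mathcomp Require Import all_classical all_reals all_analysis.
From mathcomp Require Import measurable_realfun ring lra.
Import Order.TTheory GRing.Theory Num.Theory.
Import numFieldNormedType.Exports.

Local Open Scope classical_set_scope.
Local Open Scope ring_scope.

(** * One-sided calculus on the half-line *)

(** Carathéodory's factor is the difference quotient, extended at [x] by the derivative. This puts
    ordinary derivatives into the slope form used by [derivable_Rp]. *)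
Lemma is_derive_slopeP (R : realType) (f : R -> R) (x d : R) :
  is_derive x 1 f d <-> (f y - f x) / (y - x) @[y --> x^'] --> d.
Proof.
split=> [/is_derive1_caratheodory[g [fE gc <-]]|sl].
  move: gc => /continuous_withinNx; apply: cvg_trans.
  apply: near_eq_cvg; near=> y; rewrite fE mulfK// subr_eq0.
  by near: y; exact: nbhs_dnbhs_neq.
apply/is_derive1_caratheodory.
exists (fun y => if y == x then d else (f y - f x) / (y - x)); split.
- move=> z; case: eqP => [->|/eqP]; first by rewrite !subrr mulr0.
  by rewrite -subr_eq0 => /divfK ->.
- apply/continuous_withinNx; rewrite eqxx.
  move: sl; apply: cvg_trans; apply: near_eq_cvg; near=> y.
  by rewrite ifN//; near: y; exact: nbhs_dnbhs_neq.
- by rewrite eqxx.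
Unshelve. all: by end_near. Qed.

Lemma within_Rp_dnbhs (R : realType) (x : R) : 0 < x ->
  within Rp x^' = x^'.
Proof.
move=> x0; rewrite eqEsubset; split=> A; last exact: cvg_within.
rewrite /within/= => nA; near=> y.
have : Rp y.
  rewrite /Rp/= in_itv/= andbT ltW//; near: y.
  by apply: nbhs_dnbhs; exact: lt_nbhsr.
by near: y.
Unshelve. all: by end_near. Qed.

(** Properness makes the limit in [derive_Rp] unique. At [x = 0] a ball of radius [e] still contains
    the admissible point [e / 2]. *)
Lemma within_Rp_proper (R : realType) (x : R) : 0 <= x ->
  ProperFilter (within Rp x^').
Proof.
rewrite le_eqVlt => /predU1P[<-|x0]; last first.
  by rewrite within_Rp_dnbhs//; exact: Proper_dnbhs_numFieldType.
apply: Build_ProperFilter_ex => P; rewrite /within/=.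
case=> e /= e0 h; exists (e / 2).
apply: h => /=.
- by rewrite sub0r normrN gtr0_norm ?divr_gt0//; lra.
- by rewrite gt_eqF// divr_gt0.
- by rewrite /Rp/= in_itv/= andbT divr_ge0// ltW.
Qed.

Lemma derive_RpP (R : realType) (f : R -> R) (x d : R) : 0 <= x ->
  (f y - f x) / (y - x) @[y --> within Rp x^'] --> d ->
  derivable_Rp f x /\ derive_Rp f x = d.
Proof.
move=> x0 fd; have := @within_Rp_proper R x x0 => ?.
split; [by apply: (cvgP d)|exact: norm_cvg_lim].
Qed.

Lemma derivable_Rp_slope (R : realType) (f : R -> R) (x : R) : 0 <= x ->
  derivable_Rp f x ->
  (f y - f x) / (y - x) @[y --> within Rp x^'] --> derive_Rp f x.
Proof. by []. Qed.

Lemma is_derive_Rp (R : realType) (f : R -> R) (x d : R) : 0 <= x ->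
  is_derive x 1 f d -> derivable_Rp f x /\ derive_Rp f x = d.
Proof.
move=> x0 /is_derive_slopeP fd; apply: derive_RpP => //.
exact: cvg_within_filter fd.
Qed.

Lemma derivable_Rp_is_derive (R : realType) (f : R -> R) (x : R) : 0 < x ->
  derivable_Rp f x -> is_derive x 1 f (derive_Rp f x).
Proof.
move=> x0 df; apply/is_derive_slopeP.
by rewrite -(within_Rp_dnbhs _ _ x0).
Qed.

(** The filter only sees points of [Rp], so the arbitrary values of total functions at negative
    arguments never enter one-sided derivatives. *)
Lemma eq_slope_Rp (R : realType) (f g : R -> R) (x : R) : 0 <= x ->
  (forall y, 0 <= y -> f y = g y) ->
  (f y - f x) / (y - x) @[y --> within Rp x^'] =
  (g y - g x) / (y - x) @[y --> within Rp x^'].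
Proof.
move=> x0 fg.
have {}fg y : Rp y -> (f y - f x) / (y - x) = (g y - g x) / (y - x).
  by rewrite /Rp/= in_itv/= andbT => y0; rewrite !fg.
rewrite eqEsubset; split=> P; rewrite /nbhs/= /within/=.
  by apply: filterS => y + Ry; rewrite -fg//; apply.
by apply: filterS => y + Ry; rewrite fg//; apply.
Qed.

Lemma eq_derivable_Rp (R : realType) (f g : R -> R) (x : R) : 0 <= x ->
  (forall y, 0 <= y -> f y = g y) -> derivable_Rp f x -> derivable_Rp g x.
Proof. by move=> x0 fg; rewrite /derivable_Rp (eq_slope_Rp _ f g). Qed.

Lemma eq_derive_Rp (R : realType) (f g : R -> R) (x : R) : 0 <= x ->
  (forall y, 0 <= y -> f y = g y) -> derive_Rp f x = derive_Rp g x.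
Proof. by move=> x0 fg; rewrite /derive_Rp (eq_slope_Rp _ f g). Qed.

Lemma derivable_Rp_cvg (R : realType) (f : R -> R) (x : R) : 0 <= x ->
  derivable_Rp f x -> f y @[y --> within Rp (nbhs x)] --> f x.
Proof.
move=> x0 /(derivable_Rp_slope _ _ _ x0) fd.
have yx : (y - x) @[y --> within Rp x^'] --> 0.
  do 2 apply: cvg_within_filter.
  have : (y - x) @[y --> x] --> x - x.
    by apply: cvgB; [exact: cvg_id|exact: cvg_cst].
  by rewrite subrr.
have FF : Filter (within Rp x^') by exact: within_filter.
(* The increment [f y - f x] is the slope times [y - x], hence tends to 0. *)
have /(_ FF) := cvgM fd yx; rewrite mulr0 => h.
apply/cvgrPdist_lt => e e0; have /cvgrPdist_lt/(_ e e0) := h.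
case=> d d0 hd; exists d => // y xy Ry.
have [->|nyx] := eqVneq y x; first by rewrite subrr normr0.
by have := hd _ xy nyx Ry; rewrite /= divfK ?subr_eq0// sub0r opprB.
Qed.

Lemma derivable_Rp_continuous (R : realType) (f : R -> R) :
  (forall x, 0 <= x -> derivable_Rp f x) -> {within Rp, continuous f}.
Proof.
move=> df; apply/subspace_continuousP => x Rpx; apply: derivable_Rp_cvg.
  by move: Rpx; rewrite /Rp/= in_itv/= andbT.
by apply: df; move: Rpx; rewrite /Rp/= in_itv/= andbT.
Qed.

Lemma is_derive_near_eq (R : realType) (f g : R -> R) (x d : R) :
  (\forall y \near x, f y = g y) -> is_derive x 1 f d -> is_derive x 1 g d.
Proof.
move=> fg df; apply/is_derive_slopeP.
have /is_derive_slopeP := df; apply: cvg_trans.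
apply: near_eq_cvg; near=> y; have -> : f y = g y.
  by near: y; exact: nbhs_dnbhs.
by have -> : f x = g x by exact: nbhs_singleton fg.
Unshelve. all: by end_near. Qed.

Lemma continuous_is_derive (R : realType) (f df : R -> R) :
  (forall x : R, is_derive x 1 f (df x)) -> continuous f.
Proof.
move=> dfx x; apply: differentiable_continuous; apply/derivable1_diffP.
by have := dfx x => ?; exact: ex_derive.
Qed.

Lemma within_continuousM (R : realType) (A : set R) (f g : R -> R) :
  {within A, continuous f} -> {within A, continuous g} ->
  {within A, continuous (fun x => f x * g x)}.
Proof.
move=> cf cg x.
by apply: (@continuousM _ (subspace A) f g); [exact: cf|exact: cg].
Qed.

Lemma within_continuous_cst (R : realType) (A : set R) (r : R) :
  {within A, continuous (fun=> r)}.
Proof. by apply: continuous_subspaceT => x; exact: cvg_cst. Qed.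

Lemma within_continuousX (R : realType) (A : set R) (f : R -> R) n :
  {within A, continuous f} -> {within A, continuous (fun x => f x ^+ n)}.
Proof.
move=> cf; elim: n => [|n IHn].
  by apply: continuous_subspaceT => x; exact: cvg_cst.
under eq_fun do rewrite exprS.
exact: within_continuousM.
Qed.

Lemma is_derive0_Rp_cst (R : realType) (f : R -> R) :
  (forall x : R, 0 < x -> is_derive x 1 f 0) ->
  {within Rp, continuous f} ->
  forall x : R, 0 <= x -> f x = f 0.
Proof.
move=> df cf x x0.
have [||c _] := @MVT_segment R f (fun=> 0) 0 x x0.
- by move=> y; rewrite in_itv/= => /andP[y0 _]; exact: df.
- apply: continuous_subspaceW cf => y.
  by rewrite /Rp/= !in_itv/= andbT => /andP[].
by rewrite mul0r => /eqP; rewrite subr_eq0 => /eqP.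
Qed.

(** Gronwall's argument applied to the square of [D], so that no sign of [D] has to be known. *)
Lemma linear_ode_unique (R : realType) (D g : R -> R) (C : R) :
  (forall x : R, 0 < x -> is_derive x 1 D (g x * D x)) ->
  (forall x : R, 0 < x -> g x <= C) ->
  {within Rp, continuous D} -> D 0 = 0 ->
  forall x : R, 0 <= x -> D x = 0.
Proof.
move=> dD gC cD D0 x x0.
(* An upper bound on [g] suffices: [H] is nonincreasing on R_+. *)
pose H := fun y => D y ^+ 2 * expR (- (2 * C) * y).
have dH (y : R) : 0 < y -> is_derive y 1 H (2 * (g y - C) * H y).
  move=> y0; have := dD _ y0 => ?.
  by apply: is_derive_eq; rewrite /H /GRing.scale/=; ring.
have cH : {within `[0, x], continuous H}.
  apply: (@continuous_subspaceW _ _ _ Rp).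
    by move=> y; rewrite /Rp/= !in_itv/= andbT => /andP[].
  apply: within_continuousM; first exact: within_continuousX.
  apply: continuous_subspaceT => {}y.
  by apply: differentiable_continuous; apply/derivable1_diffP; exact: ex_derive.
have : H x <= H 0.
  apply: (@ler0_derive1_nincr R H 0 x) => //.
  - by move=> y; rewrite in_itv/= => /andP[y0 _]; apply: ex_derive; exact: dH.
  - move=> y; rewrite in_itv/= => /andP[y0 _].
    have dHy := dH _ y0; rewrite derive1E derive_val.
    rewrite mulr_le0_ge0//; last by rewrite mulr_ge0 ?exprn_even_ge0 ?expR_ge0.
    by rewrite mulr_ge0_le0// subr_le0 gC.
rewrite /H /= D0 expr0n/= mul0r.
rewrite pmulr_lle0 ?expR_gt0// => h.
by apply/eqP; rewrite -sqrf_eq0 eq_le h sqr_ge0.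
Qed.

(** * Probability measures with a density *)

Lemma exists_density_probability (R : realType) (p : R -> R) :
  measurable_fun setT p -> (forall x, 0 <= p x) ->
  (\int[lebesgue_measure]_x (p x)%:E = 1)%E ->
  exists P : probability (measurableTypeR R) R,
    forall A, P A = (\int[lebesgue_measure]_(x in A) (p x)%:E)%E.
Proof.
move=> mp p0 p1.
pose P (A : set (measurableTypeR R)) :=
  (\int[lebesgue_measure]_(x in A) (p x)%:E)%E.
have P0 : P set0 = 0%E by rewrite /P integral_set0.
have Pge0 A : (0 <= P A)%E by rewrite /P integral_ge0// => x _; rewrite lee_fin.
have Psigma : semi_sigma_additive P.
  move=> /= F mF tF mUF; rewrite /P; apply: cvg_toP.
    apply: ereal_nondecreasing_is_cvgn => m n mn.
    apply: lee_sum_nneg_natr => // k _ _; apply: integral_ge0 => /= x Fkx.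
    by rewrite lee_fin.
  rewrite ge0_integral_bigcup//=.
  - exact/measurable_EFinP/measurable_funTS.
  - by move=> x _; rewrite lee_fin.
have P1 : P setT = 1%E by [].
pose M := isMeasure.Build _ _ R P P0 Pge0 Psigma.
pose PM : {measure set (measurableTypeR R) -> \bar R} := HB.pack P M.
pose N := @Measure_isProbability.Build _ _ R PM P1.
pose PP : probability (measurableTypeR R) R := HB.pack P M N.
by exists PP.
Qed.

(** [P] is dominated by Lebesgue measure, and its Radon-Nikodym derivative agrees almost everywhere
    with [p] because both have the same integrals over measurable sets. Boundedness of [f] gives
    integrability against [P]. *)
Lemma integral_density (R : realType) (p : R -> R)
    (P : probability (measurableTypeR R) R) :
  measurable_fun setT p -> (forall x, 0 <= p x) ->
  (forall A, P A = \int[lebesgue_measure]_(x in A) (p x)%:E)%E ->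
  forall (U : set R) (f : R -> R), measurable U -> measurable_fun U f ->
  (exists M, forall x, U x -> `|f x| <= M) ->
  (\int[P]_(x in U) (f x)%:E =
   \int[lebesgue_measure]_(x in U) (f x * p x)%:E)%E.
Proof.
move=> mp p0 PE U f mU mf [M fM].
have ip : lebesgue_measure.-integrable setT (EFin \o p).
  apply/integrableP; split; first exact/measurable_EFinP.
  under eq_integral do rewrite /= ger0_norm//.
  by rewrite -PE probability_setT ltry.
have Pdom : P `<< lebesgue_measure.
  apply/null_content_dominatesP => A mA A0; rewrite PE.
  by apply: null_set_integral => //; exact/measurable_EFinP/measurable_funTS.
have fi : P.-integrable U (EFin \o f).
  apply: measurable_bounded_integrable => //.
    by rewrite (le_lt_trans (probability_le1 _ _))// ltry.
  exists M; split; first exact: num_real.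
  by move=> y My x Ux; apply: le_trans (fM _ Ux) _; exact: ltW.
rewrite -(Radon_Nikodym_change_of_variables Pdom)//=.
under [RHS]eq_integral do rewrite EFinM.
apply: ae_eq_integral => //.
- apply: emeasurable_funM; first exact/measurable_EFinP.
  apply: (measurable_int lebesgue_measure).
  apply: (integrableS _ _ (@subsetT _ _)) => //=.
  exact: Radon_Nikodym_integrable.
- apply: emeasurable_funM; first exact/measurable_EFinP.
  exact/measurable_EFinP/measurable_funTS.
- apply: ae_eqe_mul2l => /=.
  apply: integral_ae_eq => //=.
  + apply: (integrableS _ _ (@subsetT _ _)) => //=.
    exact: Radon_Nikodym_integrable.
  + exact/measurable_EFinP/measurable_funTS.
  + by move=> E EU mE; rewrite -Radon_Nikodym_integral//= -PE.
Qed.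

(** * The tail of an integrable continuous function *)

Section tail_of_continuous.
Context (R : realType).
Variable u : R -> R.
Hypothesis cu : {within Rp, continuous u}.
Hypothesis iu : lebesgue_measure.-integrable Rp (EFin \o u).

Local Notation mu := (@lebesgue_measure R).

Lemma integrable_itv_Rp (x : R) : mu.-integrable `[0, x] (EFin \o u).
Proof.
apply: integrableS iu => //; rewrite /Rp; first exact: measurable_itv.
by move=> y; rewrite /= !in_itv/= andbT => /andP[].
Qed.

(** Trades the integral over an unbounded interval for one over [[0, x]], to which the fundamental
    theorem of calculus applies. *)
Lemma tailE (x : R) : 0 <= x ->
  tail u x = tail u 0 - parameterized_integral mu 0 x u.
Proof.
move=> x0; rewrite /tail /parameterized_integral Rintegral_itvB//.
rewrite Rintegral_itv_obnd_cbnd//.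
apply: integrableS iu => //; rewrite /Rp; first exact: measurable_itv.
by move=> y; rewrite /= !in_itv/= !andbT => /ltW; exact: le_trans.
Qed.

Lemma is_derive_tail (x : R) : 0 < x -> is_derive x 1 (tail u) (- u x).
Proof.
move=> x0.
have cux : {for x, continuous u}.
  move: cu => /continuous_within_itvcyP[+ _]; apply.
  by rewrite in_itv/= x0.
(* The fundamental theorem needs an interval reaching strictly beyond [x]; the length 1 is
   arbitrary. *)
have x1 : x < x + 1 by rewrite ltrDl.
have [dF F'] :=
  @continuous_FTC1_closed R u 0 x _ x1 (integrable_itv_Rp _) x0 cux.
apply: (@is_derive_near_eq _
    (fun y => tail u 0 - parameterized_integral mu 0 y u)).
  by near=> y; rewrite -tailE// ltW//; near: y; exact: lt_nbhsr.
have dF' : is_derive x 1 (fun y => parameterized_integral mu 0 y u) (u x).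
  by apply: DeriveDef; [exact: dF|rewrite -derive1E F'].
by apply: is_derive_eq; rewrite add0r mul1r.
Unshelve. all: by end_near. Qed.

Lemma within_continuous_tail : {within Rp, continuous (tail u)}.
Proof.
apply/continuous_within_itvcyP; split.
  move=> x; rewrite in_itv/= andbT => x0.
  apply: differentiable_continuous; apply/derivable1_diffP.
  by have := is_derive_tail _ x0 => ?; exact: ex_derive.
(* At the endpoint 0 only a right limit is required: the integral over [[0, y]] tends to 0. *)
have /= h :=
  @parameterized_integral_cvg_left R 0 1 u ltr01 (integrable_itv_Rp _).
apply: (@cvg_trans _
    ((fun y => tail u 0 - parameterized_integral mu 0 y u) @ 0^'+)).
  by apply: near_eq_cvg; near=> y; rewrite -tailE.
have {h} : tail u 0 - parameterized_integral mu 0 y u @[y --> 0^'+] -->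
    tail u 0 - 0.
  by apply: cvgB; [exact: cvg_cst|exact: cvg_at_right_filter].
by rewrite subr0.
Unshelve. all: by end_near. Qed.

Hypothesis u0 : forall x, 0 <= x -> 0 <= u x.

Lemma tail_ge0 (x : R) : 0 <= x -> 0 <= tail u x.
Proof.
move=> x0; apply: Rintegral_ge0 => y /=; rewrite in_itv/= andbT => xy.
by rewrite u0// (le_trans x0).
Qed.

Lemma tail_le0 (x : R) : 0 <= x -> tail u x <= tail u 0.
Proof.
move=> x0; rewrite tailE// gerBl; apply: Rintegral_ge0 => y /=.
by rewrite in_itv/= => /andP[y0 _]; exact: u0.
Qed.

(** Monotone convergence: the integrals over [[0, n]] exhaust the integral over [Rp], and the tail
    is the remainder. *)
Lemma tail_small (e : R) : 0 < e -> exists2 x, 0 <= x & tail u x < e.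
Proof.
move=> e0.
have RpE : Rp = \bigcup_n `[0, n%:R]%classic :> set R.
  rewrite /Rp itv_bndy_bigcup_BRight; apply: eq_bigcupr => n _.
  by rewrite add0r.
have : (\int[mu]_(x in `[0%R, n%:R%R]) (u x)%:E)%E @[n --> \oo] -->
    (\int[mu]_(x in Rp) (u x)%:E)%E.
  rewrite RpE; apply: ge0_nondecreasing_set_cvg_integral => //.
  - apply/nondecreasing_seqP => n; rewrite subsetEset; apply: subset_itvl.
    by rewrite bnd_simp ler_nat.
  - by move=> n; exact: (measurable_int mu (integrable_itv_Rp _)).
  - by move=> n x; rewrite /= in_itv/= lee_fin => /andP[+ _]; exact: u0.
rewrite -[X in _ --> X]fineK; last first.
  by apply: integrable_fin_num => //; exact: measurable_itv.
move=> /fine_cvg /cvgrPdist_lt /(_ e e0)[N _ /(_ N (leqnn N))/= hN].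
exists N%:R => //; apply: le_lt_trans hN.
by rewrite tailE// ler_norm.
Qed.

End tail_of_continuous.

(** * Uniqueness *)

Lemma is_derive_pow (R : realType) (f : R -> R) n (x d : R) :
  is_derive x 1 f d ->
  is_derive x 1 (fun y => f y ^+ n) (n%:R * f x ^+ n.-1 * d).
Proof.
move=> df; have -> : (fun y => f y ^+ n) = f ^+ n.
  by apply/funext => y; rewrite exprfctE.
exact: is_deriveX.
Qed.

(** The [w] of the theorem, with [n] in place of [l - 1] and [alpha] written out as [b / c1]. *)
Definition profile_base {R : realType} (a b c1 : R) (n : nat) (x : R) : R :=
  (1 - b / c1) * expR (c1 / a * n%:R * x) + b / c1.

Lemma is_derive_profile_base (R : realType) (a b c1 : R) n (x : R) :
  is_derive x 1 (profile_base a b c1 n)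
    (c1 / a * n%:R * (profile_base a b c1 n x - b / c1)).
Proof.
by apply: is_derive_eq; rewrite /profile_base /GRing.scale/=; ring.
Qed.

Lemma integrable_stationary (R : realType) (l : nat) (a b c1 : R) (u : R -> R) :
  is_stationary l a b c1 u -> lebesgue_measure.-integrable Rp (EFin \o u).
Proof.
move=> [[du _ _] u0 u1 _ _].
have cu := derivable_Rp_continuous _ _ du.
apply/integrableP; split.
  apply/measurable_EFinP; apply: subspace_continuous_measurable_fun => //.
  exact: measurable_itv.
under eq_integral => x xRp.
  rewrite /= ger0_norm; last first.
    by move: xRp; rewrite inE /Rp/= in_itv/= andbT; exact: u0.
  over.
by rewrite u1 ltry.
Qed.

Lemma stationary_flux0 (R : realType) (l : nat) (a b c1 : R) (u : R -> R) :
  is_stationary l a b c1 u ->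
  forall x : R, 0 <= x ->
    a * derive_Rp u x = (b * l%:R * tail u x ^+ l.-1 - c1) * u x.
Proof.
move=> su; have [[du ddu _] u0 u1 _ [xi _ [_ pde bc _]]] := su.
have cu := derivable_Rp_continuous _ _ du.
have cdu := derivable_Rp_continuous _ _ ddu.
have iu := integrable_stationary _ _ _ _ _ _ su.
have v1 : tail u 0 = 1 by rewrite /tail /Rintegral -/Rp u1.
pose q x := (b * l%:R * tail u x ^+ l.-1 - c1) * u x.
pose J x := q x - a * derive_Rp u x.
have cq : {within Rp, continuous q}.
  apply: within_continuousM => //; apply: within_continuousB; last first.
    exact: within_continuous_cst.
  apply: within_continuousM; first exact: within_continuous_cst.
  by apply: within_continuousX; exact: within_continuous_tail.
have cJ : {within Rp, continuous J}.
  apply: within_continuousB => //; apply: within_continuousM => //.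
  exact: within_continuous_cst.
have dJ (x : R) : 0 < x -> is_derive x 1 J 0.
  move=> x0.
  have dux := derivable_Rp_is_derive _ _ _ x0 (du _ (ltW x0)).
  have ddux := derivable_Rp_is_derive _ _ _ x0 (ddu _ (ltW x0)).
  have dvx := is_derive_tail _ _ cu iu _ x0.
  (* Only the existence of this derivative is needed; its value [a u''] comes from the equation,
     whose time derivative is zero. The time 1 below is arbitrary. *)
  have dq : is_derive x 1 q ('D_1 q x).
    have dvl := is_derive_pow _ _ l.-1 _ _ dvx.
    by apply: DeriveDef => //; rewrite /q; apply: ex_derive.
  have := pde x 1 x0 ltr01.
  rewrite /dt derive1_cst /dx (is_derive_Rp _ _ _ _ (ltW x0) dq).2.
  move=> e; rewrite /J; apply: is_derive_eq.
  rewrite /GRing.scale/=; lra.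
move=> x x0; apply/esym/eqP; rewrite -subr_eq0 -/(q x) -/(J x).
rewrite (is_derive0_Rp_cst _ _ dJ cJ)//; apply/eqP.
(* Since [v = 1] at [x = 0], the flux there is the negative of the boundary expression. *)
have := bc 1 ltr01; rewrite /J /q v1 expr1n mulr1 /dx => h.
lra.
Qed.

Lemma stationary_first_integral (R : realType) (k : nat) (a b c1 : R)
    (u : R -> R) :
  0 < a -> 0 < b -> b <= c1 -> is_stationary k.+2 a b c1 u ->
  forall x : R, 0 <= x ->
    a * u x = c1 * tail u x - b * tail u x ^+ k.+2.
Proof.
move=> a0 b0 bc1 su; have flux := stationary_flux0 _ _ _ _ _ _ su.
have [[du _ _] u0 u1 _ _] := su.
have cu := derivable_Rp_continuous _ _ du.
have iu := integrable_stationary _ _ _ _ _ _ su.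
have v1 : tail u 0 = 1 by rewrite /tail /Rintegral -/Rp u1.
have c10 : 0 < c1 by exact: lt_le_trans bc1.
pose K x := a * u x + b * tail u x ^+ k.+2 - c1 * tail u x.
have ccst (r : R) : {within (Rp : set R), continuous (fun=> r)}.
  exact: within_continuous_cst.
have cv := within_continuous_tail _ _ cu iu.
have cK : {within Rp, continuous K}.
  apply: within_continuousB; last exact: within_continuousM.
  apply: within_continuousD; first exact: within_continuousM.
  by apply: within_continuousM => //; exact: within_continuousX.
have dK (x : R) : 0 < x -> is_derive x 1 K 0.
  move=> x0.
  have dux := derivable_Rp_is_derive _ _ _ x0 (du _ (ltW x0)).
  have dvx := is_derive_tail _ _ cu iu _ x0.
  have dvl := is_derive_pow _ _ k.+2 _ _ dvx.
  (* The derivative is [a u' - (b l v^(l-1) - c1) u], which is zero by the vanishing flux. *)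
  rewrite /K; apply: is_derive_eq.
  by rewrite /GRing.scale/= flux ?ltW//=; ring.
have KE := is_derive0_Rp_cst _ _ dK cK.
have vge0 (x : R) : 0 <= x -> 0 <= tail u x by exact: tail_ge0.
have vle1 (x : R) : 0 <= x -> tail u x <= 1.
  by move=> x0; rewrite -v1; exact: tail_le0.
suff K0 : K 0 = 0.
  by move=> x x0; have := KE x x0; rewrite K0 /K; lra.
apply/eqP; rewrite eq_le; apply/andP; split; rewrite leNgt; apply/negP => k0.
(* [c1 v - b v^l >= 0] because [0 <= v <= 1], so [K 0 > 0] bounds [u] away
   from 0 and would make [v] negative eventually. *)
- have ux (x : R) : 0 <= x -> K 0 / a <= u x.
    move=> x0; rewrite ler_pdivrMr// mulrC -(KE x x0) /K -addrA gerDl subr_le0.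
    apply: ler_pM => //; rewrite ?exprn_ge0 ?vge0 ?(ltW b0)//.
    by rewrite exprS ler_piMr ?vge0// exprn_ile1 ?vge0 ?vle1.
  (* On [[0, x]] the lower bound [K 0 / a] accumulates mass [K 0 / a * x = 2], more than the total
     mass 1. *)
  have [x xE] : exists x, x = 2 * a / K 0 by eexists.
  have x0 : 0 < x by rewrite xE divr_gt0// mulr_gt0.
  have [||y + vx] := @MVT_segment R (tail u) (fun y => - u y) 0 x (ltW x0).
  + by move=> y; rewrite in_itv/= => /andP[y0 _]; exact: is_derive_tail.
  + apply: continuous_subspaceW cv => y; rewrite /Rp/= !in_itv/= andbT.
    by move=> /andP[].
  rewrite in_itv/= => /andP[y0 _].
  have := vge0 _ (ltW x0); rewrite leNgt => /negP; apply.
  have -> : tail u x = 1 - u y * x by move: vx; rewrite subr0 v1; lra.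
  have : K 0 / a * x <= u y * x by rewrite ler_pM2r// ux.
  have -> : K 0 / a * x = 2 by rewrite xE; field; rewrite !gt_eqF.
  lra.
(* Once [c1 v < - K 0], the sum [a u + b v^l = K 0 + c1 v] would be negative, although both terms
   are nonnegative. *)
- have e0 : 0 < - K 0 / c1 by rewrite divr_gt0// oppr_gt0.
  have [x x0] := tail_small _ _ iu u0 _ e0.
  rewrite ltr_pdivlMr// => h.
  have : 0 <= a * u x by rewrite mulr_ge0 ?u0// ltW.
  have : 0 <= b * tail u x ^+ k.+2 by rewrite mulr_ge0 ?exprn_ge0 ?vge0// ltW.
  by have := KE _ x0; rewrite {1}/K; lra.
Qed.

(** The product form avoids dividing by the tail, so far only known to be nonnegative; positivity
    then follows from the identity itself. *)
Lemma stationary_profile (R : realType) (k : nat) (a b c1 : R) (u : R -> R) :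
  0 < a -> 0 < b -> b <= c1 -> is_stationary k.+2 a b c1 u ->
  forall x : R, 0 <= x ->
    profile_base a b c1 k.+1 x * tail u x ^+ k.+1 = 1.
Proof.
move=> a0 b0 bc1 su.
have fi := stationary_first_integral _ _ _ _ _ _ a0 b0 bc1 su.
have [[du _ _] u0 u1 _ _] := su.
have cu := derivable_Rp_continuous _ _ du.
have iu := integrable_stationary _ _ _ _ _ _ su.
have v1 : tail u 0 = 1 by rewrite /tail /Rintegral -/Rp u1.
have c10 : 0 < c1 by exact: lt_le_trans bc1.
pose w := profile_base a b c1 k.+1.
pose D x := w x * tail u x ^+ k.+1 - 1.
suff D0 : forall x : R, 0 <= x -> D x = 0.
  by move=> x /D0 /eqP; rewrite subr_eq0 => /eqP.
(* With [n = l - 1], [w' = n (c1 w - b) / a] and [v' = - (c1 v - b v^l) / a]. In [D'] the terms with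
   [c1] cancel, leaving [(n b / a) v^n (w v^n - 1)]; the coefficient is bounded because [v <= 1]. *)
apply: (@linear_ode_unique _ D (fun x => k.+1%:R * b / a * tail u x ^+ k.+1)
  (k.+1%:R * b / a)).
- move=> x x0.
  have dwx := is_derive_profile_base _ a b c1 k.+1 x.
  have dvx := is_derive_tail _ _ cu iu _ x0.
  have dvm := is_derive_pow _ _ k.+1 _ _ dvx.
  rewrite /D /w; apply: is_derive_eq.
  have -> : u x = (c1 * tail u x - b * tail u x ^+ k.+2) / a.
    by rewrite -fi ?ltW// mulrC mulKf// gt_eqF.
  rewrite /GRing.scale/= !exprS; field.
  by rewrite !gt_eqF.
- move=> x x0; rewrite ler_piMr//.
    by rewrite divr_ge0 ?mulr_ge0// ltW.
  apply: exprn_ile1; first by apply: tail_ge0 => //; exact: ltW.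
  by rewrite -v1; apply: tail_le0 => //; exact: ltW.
- apply: within_continuousB; last exact: within_continuous_cst.
  apply: within_continuousM; last first.
    by apply: within_continuousX; exact: within_continuous_tail.
  apply: continuous_subspaceT => x; apply: differentiable_continuous.
  have dwx := is_derive_profile_base _ a b c1 k.+1 x.
  by apply/derivable1_diffP; exact: ex_derive.
- by rewrite /D v1 expr1n /w /profile_base mulr0 expR0; ring.
Qed.

(** * Existence *)

Lemma cvg_expR_scale (R : realType) (r : R) : 0 < r ->
  expR (- (r * x)) @[x --> +oo] --> 0.
Proof.
move=> r0; apply: (@cvg_comp _ _ _ (fun x => r * x) (fun z => expR (- z)) _
  (pinfty_nbhs R)).
  exact: gt0_cvgMry.
exact: cvgr_expR.
Qed.

Lemma integral_exp_bound_lty (R : realType) (f : R -> R) (C r : R) :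
  0 < r -> measurable_fun Rp f -> (forall x, 0 <= x -> 0 <= f x) ->
  (forall x, 0 <= x -> f x <= C * expR (- (r * x))) ->
  (\int[lebesgue_measure]_(x in Rp) (f x)%:E < +oo)%E.
Proof.
move=> r0 mf f0 fC.
(* The sign of [C] is forced by the two bounds on [f] at 0. *)
have C0 : 0 <= C.
  have := le_trans (f0 0 (lexx _)) (fC 0 (lexx _)).
  by rewrite mulr0 oppr0 expR0 mulr1.
have dE (x : R) : is_derive x 1 (fun x => - (C / r) * expR (- (r * x)))
    (C * expR (- (r * x))).
  by apply: is_derive_eq; rewrite /GRing.scale/=; field; rewrite gt_eqF.
have cE : continuous (fun x => C * expR (- (r * x))).
  apply: (@continuous_is_derive _ _ (fun x => C * (- r * expR (- (r * x))))).
  by move=> x; apply: is_derive_eq; rewrite /GRing.scale/=; ring.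
apply: (@le_lt_trans _ _
    (\int[lebesgue_measure]_(x in Rp) (C * expR (- (r * x)))%:E)%E).
  apply: ge0_le_integral => //.
  - exact: measurable_itv.
  - by move=> x; rewrite /Rp/= in_itv/= andbT lee_fin; exact: f0.
  - exact/measurable_EFinP.
  - apply/measurable_EFinP/measurable_funTS.
    exact: continuous_measurable_fun.
  - by move=> x; rewrite /Rp/= in_itv/= andbT lee_fin; exact: fC.
rewrite (@ge0_continuous_FTC2y _ _ (fun x => - (C / r) * expR (- (r * x))) _ 0)
  ?ltry//.
- by move=> x _; rewrite mulr_ge0// expR_ge0.
- exact: continuous_subspaceT.
- rewrite -(mulr0 (- (C / r))); apply: cvgM; first exact: cvg_cst.
  exact: cvg_expR_scale.
- by apply: cvg_at_right_filter; exact: (continuous_is_derive _ _ _ dE).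
- by move=> x _; rewrite derive1E derive_val.
Qed.

(** * The explicit profile: closed forms, derivatives and decay *)

Section stationary_existence.
Context (R : realType).
Variables (k : nat) (a b c1 : R).
Hypotheses (a0 : 0 < a) (b0 : 0 < b) (bc1 : b < c1).

Local Notation mu := (@lebesgue_measure R).
Local Notation w := (profile_base a b c1 k.+1).

Let c10 : 0 < c1. Proof. exact: lt_trans bc1. Qed.

Lemma profile_ratio_lt1 : b / c1 < 1.
Proof. by rewrite ltr_pdivrMr// mul1r. Qed.

Lemma profile_base_gt0 x : 0 < w x.
Proof.
rewrite /profile_base addr_gt0 ?divr_gt0// mulr_gt0 ?expR_gt0//.
by rewrite subr_gt0 profile_ratio_lt1.
Qed.

(** A convex combination of 1 and an exponential that is at least 1. *)
Lemma profile_base_ge1 x : 0 <= x -> 1 <= w x.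
Proof.
move=> x0; rewrite /profile_base -lerBlDr ler_peMr//.
  by rewrite subr_ge0 ltW// profile_ratio_lt1.
by rewrite -[leLHS]expR0 ler_expR !mulr_ge0// ?invr_ge0 ?ltW.
Qed.

(** The power [w^(-1/(l-1))] with [l = k + 2], spelled with [expR] and [ln] for direct
    differentiation. *)
Definition stat_tail (x : R) := expR (- k.+1%:R^-1 * ln (w x)).

(** Read off from the first integral [a u = c1 v - b v^l]; this form is easier to differentiate than
    the closed formula of the theorem. *)
Definition stat_density (x : R) :=
  (c1 * stat_tail x - b * stat_tail x ^+ k.+2) / a.

Local Notation V := stat_tail.
Local Notation U := stat_density.

Lemma stat_tail_powRE x : V x = w x `^ (- k.+1%:R^-1).
Proof. by rewrite /powR gt_eqF ?profile_base_gt0. Qed.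

Lemma stat_tailX x : V x ^+ k.+1 = (w x)^-1.
Proof.
rewrite /stat_tail -expRM_natl mulrA mulrN divff// mulN1r expRN lnK//.
by rewrite posrE profile_base_gt0.
Qed.

Lemma stat_tail_gt0 x : 0 < V x. Proof. exact: expR_gt0. Qed.

Lemma stat_tail_le1 x : 0 <= x -> V x <= 1.
Proof.
move=> x0; rewrite /stat_tail expR_le1 mulNr oppr_le0 mulr_ge0 ?invr_ge0//.
by rewrite ln_ge0// profile_base_ge1.
Qed.

Lemma stat_tail0 : V 0 = 1.
Proof.
by rewrite /stat_tail /profile_base mulr0 expR0 mulr1 subrK ln1 mulr0 expR0.
Qed.

(** Because [V^(l-1) = 1 / w], the first integral gives [U = (c1 / a) (w - b / c1) V / w], and
    [w - b / c1] is the exponential part of [w]. *)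
Lemma stat_densityE x :
  U x = c1 / a * (1 - b / c1) * expR (c1 / a * k.+1%:R * x) * (V x / w x).
Proof.
have w0 := profile_base_gt0 x.
have -> : expR (c1 / a * k.+1%:R * x) = (w x - b / c1) / (1 - b / c1).
  rewrite /profile_base addrK [RHS]mulrAC divff ?mul1r//.
  rewrite subr_eq0 eq_sym lt_eqF//.
  exact: profile_ratio_lt1.
rewrite /stat_density exprS stat_tailX; field.
by rewrite !gt_eqF//= subr_gt0 bc1.
Qed.

(** Logarithmic differentiation gives [V' = - V w' / ((l-1) w) = - V (c1 - b / w) / a], and
    [1 / w = V^(l-1)]. *)
Lemma is_derive_stat_tail (x : R) : is_derive x 1 V (- U x).
Proof.
have w0 := profile_base_gt0 x.
have dw := is_derive_profile_base R a b c1 k.+1 x.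
have dln := is_derive1_ln w0.
rewrite /stat_tail; apply: is_derive_eq.
rewrite -/(V x) /stat_density [V x ^+ k.+2]exprS stat_tailX /GRing.scale/=.
by field; rewrite !gt_eqF// ltr0Sn.
Qed.

(* Chosen so that [stat_density' = stat_drift * stat_density]; [a] times this
   identity is the vanishing of the flux. *)
Definition stat_drift (x : R) := (b * k.+2%:R * V x ^+ k.+1 - c1) / a.

Lemma is_derive_stat_density (x : R) : is_derive x 1 U (stat_drift x * U x).
Proof.
have dV := is_derive_stat_tail x.
have dVX := is_derive_pow _ _ k.+2 _ _ dV.
rewrite {1}/stat_density; apply: is_derive_eq.
by rewrite /GRing.scale/= /stat_drift; field; rewrite gt_eqF.
Qed.

Lemma is_derive_stat_drift (x : R) : is_derive x 1 stat_drift
  (- (b * k.+2%:R * k.+1%:R * V x ^+ k * U x) / a).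
Proof.
have dV := is_derive_stat_tail x.
have dVX := is_derive_pow _ _ k.+1 _ _ dV.
rewrite /stat_drift; apply: is_derive_eq.
by rewrite /GRing.scale/=; field; rewrite gt_eqF.
Qed.

Definition stat_density2 (x : R) :=
  stat_drift x ^+ 2 * U x - b * k.+2%:R * k.+1%:R * V x ^+ k * U x ^+ 2 / a.

Lemma is_derive2_stat_density (x : R) :
  is_derive x 1 (fun y => stat_drift y * U y) (stat_density2 x).
Proof.
have dU := is_derive_stat_density x.
have dD := is_derive_stat_drift x.
apply: is_derive_eq; rewrite /GRing.scale/= /stat_density2.
by field; rewrite gt_eqF.
Qed.

Lemma continuous_stat_density2 : continuous stat_density2.
Proof.
have cU := continuous_is_derive _ _ _ is_derive_stat_density.
have cV := continuous_is_derive _ _ _ is_derive_stat_tail.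
have cD := continuous_is_derive _ _ _ is_derive_stat_drift.
have cX (f : R -> R) n : continuous f -> continuous (fun x => f x ^+ n).
  move=> cf x; apply: (@continuous_comp _ _ _ f (@GRing.exp R ^~ n)).
    exact: cf.
  exact: exprn_continuous.
move=> x; apply: cvgB; first by apply: cvgM; [exact: cX|exact: cU].
apply: cvgM; last exact: cvg_cst.
apply: cvgM; last exact: cX.
by apply: cvgM; [exact: cvg_cst|exact: cX].
Qed.

(** [b < c1], and [V^l <= V] because [0 < V <= 1] on the half-line. *)
Lemma stat_density_ge0 x : 0 <= x -> 0 <= U x.
Proof.
move=> x0; rewrite divr_ge0 ?(ltW a0)// subr_ge0.
apply: ler_pM;
  rewrite ?exprn_ge0 ?(ltW (stat_tail_gt0 _)) ?(ltW b0) ?(ltW bc1)//.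
rewrite exprS ler_piMr ?(ltW (stat_tail_gt0 _))// exprn_ile1 ?stat_tail_le1//.
exact/ltW/stat_tail_gt0.
Qed.

Lemma stat_density_le x : U x <= c1 / a * V x.
Proof.
rewrite /stat_density mulrAC ler_pM2r ?invr_gt0// gerBl.
by rewrite mulr_ge0 ?(ltW b0)// exprn_ge0// ltW// stat_tail_gt0.
Qed.

(** The number [(1 - alpha)^(-1/(l-1))]. *)
Definition stat_const : R := expR (- k.+1%:R^-1 * ln (1 - b / c1)).

(** Dropping the summand [alpha] from [w] leaves a pure exponential of rate [(c1 / a) (l-1)], and
    the negative power [-1/(l-1)] reverses the inequality. *)
Lemma stat_tail_le_exp x : V x <= stat_const * expR (- (c1 / a * x)).
Proof.
have r1 : 0 < 1 - b / c1 by rewrite subr_gt0 profile_ratio_lt1.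
rewrite /stat_tail /stat_const -expRD ler_expR.
have -> : - k.+1%:R^-1 * ln (1 - b / c1) + - (c1 / a * x) =
    - k.+1%:R^-1 * (ln (1 - b / c1) + c1 / a * k.+1%:R * x).
  by field; rewrite !gt_eqF// ltr0Sn.
rewrite ler_nM2l ?oppr_lt0 ?invr_gt0 ?ltr0Sn//.
rewrite -[X in _ + X]expRK -lnM ?posrE ?expR_gt0//.
rewrite ler_ln ?posrE ?mulr_gt0 ?expR_gt0 ?profile_base_gt0//.
by rewrite /profile_base lerDl divr_ge0// ltW.
Qed.

Lemma cvg_stat_tail : V x @[x --> +oo] --> 0.
Proof.
apply: (@squeeze_cvgr _ _ _ _ (cst 0)
    (fun x => stat_const * expR (- (c1 / a * x)))); last 2 first.
- exact: cvg_cst.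
- rewrite -(mulr0 stat_const); apply: cvgM; first exact: cvg_cst.
  by apply: cvg_expR_scale; rewrite divr_gt0.
by near=> x; rewrite stat_tail_le_exp ltW// stat_tail_gt0.
Unshelve. all: by end_near. Qed.

Lemma integral_stat_density (x : R) : 0 <= x ->
  (\int[mu]_(y in `[x, +oo[) (U y)%:E = (V x)%:E)%E.
Proof.
move=> x0; rewrite (@ge0_continuous_FTC2y _ _ (fun x => - V x) _ 0).
- by rewrite -EFinD opprK add0r.
- by move=> y xy; rewrite stat_density_ge0// (le_trans x0).
- apply: continuous_subspaceT.
  exact: continuous_is_derive _ _ _ is_derive_stat_density.
- by rewrite -oppr0; apply: cvgN; exact: cvg_stat_tail.
- by move=> y _; have dV := is_derive_stat_tail y; exact: ex_derive.
- apply: cvg_at_right_filter; apply: cvgN.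
  exact: (continuous_is_derive _ _ _ is_derive_stat_tail).
- move=> y _; have dV := is_derive_stat_tail y.
  by rewrite derive1E derive_val opprK.
Qed.

Lemma tail_stat_density (x : R) : 0 <= x -> tail U x = V x.
Proof. by move=> x0; rewrite /tail /Rintegral integral_stat_density. Qed.

(** Half of the decay rate [c1 / a] of [U] absorbs the power of [x]; the other half keeps the
    integral finite. *)
Lemma integral_moment_stat_density n :
  (\int[mu]_(x in Rp) (x ^+ n.+1 * U x)%:E < +oo)%E.
Proof.
pose r := c1 / a / 2.
have r0 : 0 < r by rewrite !divr_gt0.
have cU := continuous_is_derive _ _ _ is_derive_stat_density.
apply: (@integral_exp_bound_lty _ _
  (r ^- n.+1 * n.+1`!%:R * (c1 / a * stat_const)) r) => //.
- apply: measurable_funTS; apply: continuous_measurable_fun => x.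
  by apply: cvgM; [exact: exprn_continuous|exact: cU].
- by move=> x x0; rewrite mulr_ge0 ?exprn_ge0// stat_density_ge0.
- move=> x x0.
  have -> : expR (- (r * x)) = expR (r * x) * expR (- (c1 / a * x)).
    by rewrite -expRD; congr expR; rewrite /r; field; rewrite gt_eqF.
  (* A single term of the exponential series: [(r x)^(n+1) / (n+1)!] is at most [expR (r * x)]. *)
  have xn : x ^+ n.+1 <= r ^- n.+1 * n.+1`!%:R * expR (r * x).
    have rx0 : 0 <= r * x by rewrite mulr_ge0// ltW.
    have := expR_ge1Dxn n rx0; rewrite exprMn => h.
    rewrite -mulrA ler_pdivlMl ?exprn_gt0// -ler_pdivrMl ?ltr0n ?fact_gt0//.
    by rewrite mulrC; apply: le_trans h; rewrite lerDr.
  rewrite mulrACA; apply: ler_pM => //; first exact: exprn_ge0.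
  + exact: stat_density_ge0.
  + rewrite -(mulrA (c1 / a)); apply: le_trans (stat_density_le _) _.
    by rewrite ler_pM2l ?divr_gt0// stat_tail_le_exp.
Qed.

End stationary_existence.

(** * Smooth functions of [x] alone as functions on the half-line and in space-time *)

Section smooth_on_Rp.
Context (R : realType).
Variables f f1 f2 : R -> R.
Hypotheses (df : forall x : R, is_derive x 1 f (f1 x))
  (df1 : forall x : R, is_derive x 1 f1 (f2 x)) (cf2 : continuous f2).

Lemma derive_Rp_smooth (x : R) : 0 <= x -> derive_Rp f x = f1 x.
Proof. by move=> x0; exact: (is_derive_Rp _ _ _ _ x0 (df x)).2. Qed.

Lemma derive2_Rp_smooth (x : R) : 0 <= x -> derive_Rp (derive_Rp f) x = f2 x.
Proof.
(* [derive_Rp f] is known to equal [f1] only on [Rp], which is all that the second one-sided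
   derivative sees. *)
move=> x0; rewrite (eq_derive_Rp _ _ f1)//; last exact: derive_Rp_smooth.
exact: (is_derive_Rp _ _ _ _ x0 (df1 x)).2.
Qed.

Lemma derivable_Rp_smooth (x : R) : 0 <= x -> derivable_Rp f x.
Proof. by move=> x0; exact: (is_derive_Rp _ _ _ _ x0 (df x)).1. Qed.

Lemma derivable2_Rp_smooth (x : R) : 0 <= x -> derivable_Rp (derive_Rp f) x.
Proof.
move=> x0; apply: (eq_derivable_Rp _ f1) => //.
  by move=> y y0; rewrite derive_Rp_smooth.
exact: (is_derive_Rp _ _ _ _ x0 (df1 x)).1.
Qed.

Lemma C2_Rp_smooth : C2_Rp f.
Proof.
split; [exact: derivable_Rp_smooth|exact: derivable2_Rp_smooth|].
apply: (@subspace_eq_continuous _ Rp _ f2); last exact: continuous_subspaceT.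
move=> x; rewrite inE /Rp/= in_itv/= andbT => x0.
by rewrite /from_subspace derive2_Rp_smooth.
Qed.

Lemma continuous_xt_time_cst (u : R -> R -> R) (g : R -> R) :
  continuous g -> (forall x t, 0 <= x -> u x t = g x) -> continuous_xt u.
Proof.
move=> cg ug; rewrite /continuous_xt.
apply: (@subspace_eq_continuous _ _ _ (fun z : R * R => g z.1)).
  by move=> z; rewrite inE/= => -[z0 _]; rewrite /from_subspace ug.
apply: continuous_subspaceT => z; apply: continuous_comp; last exact: cg.
exact: cvg_fst.
Qed.

Lemma C21_time_cst : C21 (fun x _ => f x).
Proof.
split=> [x t x0 t0|].
  split; first exact: derivable_Rp_smooth.
    exact: derivable2_Rp_smooth.
  exact: derivable_cst.
split.
- by apply: (continuous_xt_time_cst _ f) => //; exact: continuous_is_derive df.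
- apply: (continuous_xt_time_cst _ f1); first exact: continuous_is_derive df1.
  by move=> x t; exact: derive_Rp_smooth.
- apply: (continuous_xt_time_cst _ f2) => //.
  by move=> x t; exact: derive2_Rp_smooth.
- apply: (continuous_xt_time_cst _ (cst 0)); first by move=> x; exact: cvg_cst.
  by move=> x t _; rewrite /dt derive1_cst.
Qed.

End smooth_on_Rp.

Lemma exists_density_probability_Rp (R : realType) (f : R -> R) :
  continuous f -> (forall x, 0 <= x -> 0 <= f x) ->
  (\int[lebesgue_measure]_(x in Rp) (f x)%:E = 1)%E ->
  exists2 P : probability (measurableTypeR R) R,
    (forall A : set (measurableTypeR R), measurable A ->
      (P A = \int[lebesgue_measure]_(x in A `&` Rp) (f x)%:E)%E) &
    (forall phi : R -> R, measurable_fun Rp phi ->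
      (exists M, forall x, 0 <= x -> `|phi x| <= M) ->
      Rintegral P Rp phi =
      Rintegral lebesgue_measure Rp (fun x => phi x * f x)).
Proof.
move=> cf f0 f1.
have mRp : measurable (Rp : set R) by exact: measurable_itv.
have RpP (x : R) : Rp x <-> 0 <= x by rewrite /Rp/= in_itv/= andbT.
(* [f] may be negative to the left of 0, so the density on the whole line is its extension by
   zero. *)
pose p := f \_ Rp.
have mp : measurable_fun setT p.
  apply/(measurable_restrictT f mRp); apply: measurable_funTS.
  exact: continuous_measurable_fun.
have p0 x : 0 <= p x.
  by rewrite /p patchE; case: ifPn => //; rewrite inE => /RpP; exact: f0.
have pE A : (\int[lebesgue_measure]_(x in A) (p x)%:E =
    \int[lebesgue_measure]_(x in A `&` Rp) (f x)%:E)%E.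
  rewrite integral_mkcondr; apply: eq_integral => x _.
  by rewrite /p !patchE; case: ifPn.
have p1 : (\int[lebesgue_measure]_x (p x)%:E = 1)%E by rewrite pE setTI.
have [P PE] := exists_density_probability _ _ mp p0 p1.
exists P => [A mA|phi mphi [M phiM]]; first by rewrite PE pE.
rewrite /Rintegral (integral_density _ _ _ mp p0 PE)//; last first.
  by exists M => x /RpP; exact: phiM.
congr fine; apply: eq_integral => x xRp.
by rewrite /p patchE xRp.
Qed.

Lemma is_stationary_stat_density (R : realType) (k : nat) (a b c1 : R) :
  0 < a -> 0 < b -> b < c1 ->
  is_stationary k.+2 a b c1 (stat_density R k a b c1).
Proof.
move=> a0 b0 bc1; set U := stat_density R k a b c1.
have dU (x : R) := is_derive_stat_density R k a b c1 a0 b0 bc1 x.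
have ddU (x : R) := is_derive2_stat_density R k a b c1 a0 b0 bc1 x.
have cU2 := continuous_stat_density2 R k a b c1 a0 b0 bc1.
have cU : continuous U by exact: continuous_is_derive dU.
have U0 (x : R) : 0 <= x -> 0 <= U x by exact: stat_density_ge0.
have U1 : (\int[lebesgue_measure]_(x in Rp) (U x)%:E = 1)%E.
  by rewrite integral_stat_density// stat_tail0.
have mom n := integral_moment_stat_density R k a b c1 a0 b0 bc1 n.
have tailU (x : R) : 0 <= x -> tail U x = stat_tail R k a b c1 x.
  exact: tail_stat_density.
have aD (x : R) : a * (stat_drift R k a b c1 x * U x) =
    (b * k.+2%:R * stat_tail R k a b c1 x ^+ k.+1 - c1) * U x.
  by rewrite /stat_drift; field; rewrite gt_eqF.
split; [exact: C2_Rp_smooth ddU cU2|exact: U0|exact: U1|exact: (mom 1%N)|].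
have [P PE Pphi] := exists_density_probability_Rp _ _ cU U0 U1.
exists P => //; split.
- split; [by move=> x t x0 _; exact: U0|exact: C21_time_cst ddU cU2|].
  move=> T; apply: le_lt_trans (mom 0%N).
  (* Every member of the set is the same first moment, the case [n = 0] of [mom]. *)
  by apply: ge_ereal_sup => _ [t _ <-].
- move=> x t x0 t0; rewrite /dt derive1_cst /dx.
  rewrite (derive2_Rp_smooth _ _ _ _ dU ddU) ?ltW//.
  (* The convective flux equals [a U'] on [Rp], so the right-hand side becomes [- a U'' + a U'']. *)
  rewrite (eq_derive_Rp _ _ (fun y => a * (stat_drift R k a b c1 y * U y)))
    ?ltW//.
    have daD : is_derive x 1 (fun y => a * (stat_drift R k a b c1 y * U y))
        (a * stat_density2 R k a b c1 x).
      have ddUx := ddU x.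
      by apply: is_derive_eq; rewrite /GRing.scale/=.
    by rewrite (is_derive_Rp _ _ _ _ (ltW x0) daD).2 addNr.
  by move=> y y0; rewrite aD tailU.
- move=> t t0; rewrite /dx (derive_Rp_smooth _ _ _ dU)// aD.
  by rewrite stat_tail0 expr1n; ring.
(* The integral against the initial measure is the one under the limit, which is constant in
   time. *)
- move=> phi cphi bphi; rewrite Pphi//; last first.
    by apply: subspace_continuous_measurable_fun => //; exact: measurable_itv.
  exact: cvg_cst.
Qed.

Theorem proposition2p3 (R : realType) (l : nat) (a b lambda rho : R)
    (hl : (2 <= l)%N) (ha : 0 < a) (hb : 0 < b) (hlambda : 0 < lambda)
    (hrho : rho < 0) :
  let c1 := - lambda * rho + b in
  let alpha := b / c1 in
  let w := fun x : R =>
    (1 - alpha) * expR (c1 / a * (l%:R - 1) * x) + alpha in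
  [/\ alpha = (1 - lambda * (rho / b))^-1, 0 < alpha, alpha < 1 &
   exists ustat : R -> R,
     [/\ is_stationary l a b c1 ustat,
         forall u : R -> R, is_stationary l a b c1 u ->
           forall x : R, 0 <= x -> u x = ustat x,
         forall x : R, 0 <= x ->
           tail ustat x = w x `^ (- (1 / (l%:R - 1))) &
         forall x : R, 0 <= x ->
           ustat x = c1 / a * (1 - alpha)
             * expR (c1 / a * (l%:R - 1) * x)
             * w x `^ (- (l%:R / (l%:R - 1)))]].
Proof.
move=> c1 alpha w.
have bc1 : b < c1 by rewrite /c1 ltrDr mulNr oppr_gt0 pmulr_rlt0.
have c10 : 0 < c1 by exact: lt_trans bc1.
split.
- have -> : 1 - lambda * (rho / b) = c1 / b.
    by rewrite /c1; field; rewrite gt_eqF.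
  by rewrite invf_div.
- by rewrite /alpha divr_gt0.
- exact: profile_ratio_lt1.
(* Writing [l = k + 2] turns the predecessor of [l] and the real number [l - 1] into [k + 1]. *)
case: l hl @w => [//|[//|k]] _ w.
have lE : k.+2%:R - 1 = k.+1%:R :> R by rewrite -natr1 addrK.
have wE : w = profile_base a b c1 k.+1.
  by apply/funext => x; rewrite /w /profile_base lE.
have w0 x : 0 < w x by rewrite wE; exact: profile_base_gt0.
exists (stat_density R k a b c1); split.
- exact: is_stationary_stat_density.
- move=> u su x x0.
  have := stationary_first_integral _ _ _ _ _ _ ha hb (ltW bc1) su _ x0.
  have wv := stationary_profile _ _ _ _ _ _ ha hb (ltW bc1) su _ x0.
  have v0 : 0 <= tail u x.
    have [_ u0 _ _ _] := su; exact: tail_ge0.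
  have -> : tail u x = stat_tail R k a b c1 x.
    (* Both sides are nonnegative and their [k.+1]-th powers equal [1 / w]. The first integral then
       determines [u] from its tail. *)
    apply: (@pexpIrn _ k.+1) => //;
      rewrite ?nnegrE ?(ltW (stat_tail_gt0 _ _ _ _ _ _))//.
    rewrite stat_tailX//; apply: (mulfI (lt0r_neq0 (w0 x))).
    by rewrite wE wv divff// gt_eqF// profile_base_gt0.
  by move=> au; rewrite /stat_density -au mulrC mulKf// gt_eqF.
- move=> x x0; rewrite (tail_stat_density _ _ _ _ _ ha hb bc1)//.
  rewrite (stat_tail_powRE _ _ _ _ _ hb bc1) wE.
  by rewrite lE div1r.
- move=> x x0; rewrite stat_densityE// lE -wE; congr (_ * _).
  (* The exponents add up: [-1/(l-1) - 1 = -l/(l-1)]. *)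
  rewrite stat_tail_powRE// -wE -(powR_inv1 (ltW (w0 x))) -powRD; last first.
    by rewrite (gt_eqF (w0 x)) implybT.
  by congr (_ `^ _); rewrite -(natr1 k.+1); field; rewrite gt_eqF ?ltr0Sn.
Qed.
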